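(* Let $\Delta t>0$ and let $k\ge2$ be an integer. The fully discrete split discontinuous Galerkin schemes with time integrators Scheme-5$(\Delta t)$ and Scheme-5F$(\Delta t)$ described in the context preserve the discrete total energy: if $(f_h^{n+1},E_{1,h}^{n+1},E_{2,h}^{n+1},B_{3,h}^{n+1})$ is produced from $(f_h^n,E_{1,h}^n,E_{2,h}^n,B_{3,h}^n)$ by one step of either scheme, then $TE_n=TE_{n+1}$, where $$2\,TE_n=\int_{\Omega_{x_2}}\int_{\Omega_{v_2}}\int_{\Omega_{v_1}}f_h^{n}(v_1^2+v_2^2)\,dv_1dv_2dx_2+\int_{\Omega_{x_2}}\big(|E_{1,h}^n|^2+|E_{2,h}^n|^2+|B_{3,h}^n|^2\big)\,dx_2.$$
   Context: Setting (1D2V Vlasov–Maxwell): unknowns $f(x_2,v_1,v_2,t)$, $E_1(x_2,t)$, $E_2(x_2,t)$, $B_3(x_2,t)$ with $f_t+v_2f_{x_2}+(E_1+v_2B_3)f_{v_1}+(E_2-v_1B_3)f_{v_2}=0$, $\partial_tB_3=\partial_{x_2}E_1$, $\partial_tE_1=\partial_{x_2}B_3-j_1$, $\partial_tE_2=-j_2$, $j_i=\iint fv_i\,dv_1dv_2$. Domain $\Omega_{x_2}\times\Omega_{v_1}\times\Omega_{v_2}=[0,L]\times[-V_{1,c},V_{1,c}]\times[-V_{2,c},V_{2,c}]$, periodic in $x_2$. Partition each interval into cells $K_{x_2,i}=[x_{2,i-1/2},x_{2,i+1/2}]$, $K_{v_1,j_1}=[v_{1,j_1-1/2},v_{1,j_1+1/2}]$,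 $K_{v_2,j_2}=[v_{2,j_2-1/2},v_{2,j_2+1/2}]$, and let $x_{2,i}^{(l)}$, $v_{1,j_1}^{(m_1)}$, $v_{2,j_2}^{(m_2)}$ ($l,m_1,m_2=1,\dots,k+1$) be the $k+1$ Gauss quadrature points of these cells. Spaces: $\mathcal{S}_h^k$: functions that on each cell $K_{x_2,i}\times K_{v_1,j_1}\times K_{v_2,j_2}$ are polynomials of degree $\le k$ in each of $x_2,v_1,v_2$; $\mathcal{W}_h^k$: piecewise polynomials of degree $\le k$ in $x_2$; $\mathcal{Z}_h^k$: functions of $(v_1,v_2)$ that on each $K_{v_1,j_1}\times K_{v_2,j_2}$ are polynomials of degree $\le k$ in each variable. States are $(f_h,E_{1,h},E_{2,h},B_{3,h})$ with $f_h\in\mathcal{S}_h^k$ and fields in $\mathcal{W}_h^k$. Superscripts $\pm$ at an interface denote right/left limits. Each map below takes the state at index $n$ to that at $n+1$ (beginning/end of the substep) with step size $\tau$ (possibly negative); for implicit equations the new state is any solution. A hat over a quantity denotes a numerical flux (see below). Scheme-a$(\tau)$: fields unchanged. For all $j_1,j_2,m_1,m_2$, find $g=g_{j_1,j_2}^{(m_1,m_2)}\in\mathcal{W}_h^k$ such that, with $f^n(x_2)=f_h^n(x_2,v_{1,j_1}^{(m_1)},v_{2,j_2}^{(m_2)})$, $\bar g=\frac12(g+f^n)$, $a=v_{2,j_2}^{(m_2)}$, for all $i$ and $\varphi\in\mathcal{W}_h^k$: $\int_{K_{x_2,i}}\frac{g-f^n}{\tau}\varphi\,dx_2-\int_{K_{x_2,i}}a\bar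 g\,\varphi_{x_2}\,dx_2+\widehat{a\bar g}_{i+1/2}\varphi^-_{i+1/2}-\widehat{a\bar g}_{i-1/2}\varphi^+_{i-1/2}=0$. Then $f_h^{n+1}\in\mathcal{S}_h^k$ is determined by $f_h^{n+1}(x_{2,i}^{(l)},v_{1,j_1}^{(m_1)},v_{2,j_2}^{(m_2)})=g_{j_1,j_2}^{(m_1,m_2)}(x_{2,i}^{(l)})$ for all indices. Velocity form: for $\bar g\in\mathcal{Z}_h^k$ and a velocity field $(a_1,a_2)$, where $a_1$ depends at most on $v_2$ and $a_2$ at most on $v_1$, define for test $\varphi\in\mathcal{Z}_h^k$ on cell $(j_1,j_2)$ $D_{j_1,j_2}(\bar g;a_1,a_2;\varphi)=-\int_{K_{v_2,j_2}}\int_{K_{v_1,j_1}}\bar g\,(a_1\varphi_{v_1}+a_2\varphi_{v_2})\,dv_1dv_2+\int_{K_{v_2,j_2}}a_1\big[\hat{\bar g}(v_{1,j_1+1/2},v_2)\varphi(v_{1,j_1+1/2}^-,v_2)-\hat{\bar g}(v_{1,j_1-1/2},v_2)\varphi(v_{1,j_1-1/2}^+,v_2)\big]dv_2+\int_{K_{v_1,j_1}}a_2\big[\hat{\bar g}(v_1,v_{2,j_2+1/2})\varphi(v_1,v_{2,j_2+1/2}^-)-\hat{\bar g}(v_1,v_{2,j_2-1/2})\varphi(v_1,v_{2,j_2-1/2}^+)\big]dv_1$. Scheme-b$(\tau)$: $B_{3,h}$ unchanged. For all $i,l$, find $g_i^{(l)}\in\mathcal{Z}_h^k$ and numbers $E_{1,i}^{(l)},E_{2,i}^{(l)}$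 such that for all cells and $\varphi\in\mathcal{Z}_h^k$, $\int_{K_{v_2,j_2}}\int_{K_{v_1,j_1}}\frac{g_i^{(l)}-f_h^n(x_{2,i}^{(l)},\cdot)}{\tau}\varphi\,dv_1dv_2+D_{j_1,j_2}\big(\tfrac12(g_i^{(l)}+f_h^n(x_{2,i}^{(l)},\cdot));\bar E_1,\bar E_2;\varphi\big)=0$ with $\bar E_q=\frac12(E_{q,h}^n(x_{2,i}^{(l)})+E_{q,i}^{(l)})$, and $\frac{E_{q,i}^{(l)}-E_{q,h}^n(x_{2,i}^{(l)})}{\tau}=-\frac12\big(J_{q,h}^n(x_{2,i}^{(l)})+J_{q,i}^{(l)}\big)$, $q=1,2$, where $J_{q,h}^n(x_2)=\iint f_h^n(x_2,v_1,v_2)v_q\,dv_1dv_2$, $J_{q,i}^{(l)}=\iint g_i^{(l)}v_q\,dv_1dv_2$ over $\Omega_{v_1}\times\Omega_{v_2}$. Then $f_h^{n+1}\in\mathcal{S}_h^k$ and $E_{q,h}^{n+1}\in\mathcal{W}_h^k$ are determined by $f_h^{n+1}(x_{2,i}^{(l)},v_{1,j_1}^{(m_1)},v_{2,j_2}^{(m_2)})=g_i^{(l)}(v_{1,j_1}^{(m_1)},v_{2,j_2}^{(m_2)})$ and $E_{q,h}^{n+1}(x_{2,i}^{(l)})=E_{q,i}^{(l)}$. Scheme-c$(\tau)$: $E_{2,h}$ unchanged. Find $E_{1,h}^{n+1},B_{3,h}^{n+1}\in\mathcal{W}_h^k$ such that for all $i$ and $\varphi,\phi\in\mathcal{W}_h^k$,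 with $\bar E=\frac12(E_{1,h}^{n+1}+E_{1,h}^n)$, $\bar B=\frac12(B_{3,h}^{n+1}+B_{3,h}^n)$: $\int_{K_{x_2,i}}\frac{E_{1,h}^{n+1}-E_{1,h}^n}{\tau}\varphi\,dx_2=-\int_{K_{x_2,i}}\bar B\varphi_{x_2}\,dx_2+\hat{\bar B}_{i+1/2}\varphi^-_{i+1/2}-\hat{\bar B}_{i-1/2}\varphi^+_{i-1/2}$ and $\int_{K_{x_2,i}}\frac{B_{3,h}^{n+1}-B_{3,h}^n}{\tau}\phi\,dx_2=-\int_{K_{x_2,i}}\bar E\phi_{x_2}\,dx_2+\hat{\bar E}_{i+1/2}\phi^-_{i+1/2}-\hat{\bar E}_{i-1/2}\phi^+_{i-1/2}$. Then for all $i,l$, with $b=\bar B(x_{2,i}^{(l)})$, find $g_i^{(l)}\in\mathcal{Z}_h^k$ with $\int_{K_{v_1,j_1}}\int_{K_{v_2,j_2}}\frac{g_i^{(l)}-f_h^n(x_{2,i}^{(l)},\cdot)}{\tau}\varphi\,dv_2dv_1+D_{j_1,j_2}\big(\tfrac12(g_i^{(l)}+f_h^n(x_{2,i}^{(l)},\cdot));v_2b,-v_1b;\varphi\big)=0$ for all cells and $\varphi\in\mathcal{Z}_h^k$, and define $f_h^{n+1}\in\mathcal{S}_h^k$ by $f_h^{n+1}(x_{2,i}^{(l)},v_{1,j_1}^{(m_1)},v_{2,j_2}^{(m_2)})=g_i^{(l)}(v_{1,j_1}^{(m_1)},v_{2,j_2}^{(m_2)})$. Fluxes. Vlasov: central (average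 of the two one-sided limits) or upwind (pointwise along the interface, the left limit where the advection speed normal to the interface is $\ge0$, the right limit where it is $<0$); when the step size is negative, upwind is replaced by downwind (the opposite one-sided limit). Maxwell (in Scheme-c): central $\hat{\bar E}=\frac12(\bar E^++\bar E^-)$, $\hat{\bar B}=\frac12(\bar B^++\bar B^-)$, or alternating $\hat{\bar E}=\bar E^+,\hat{\bar B}=\bar B^-$, or $\hat{\bar E}=\bar E^-,\hat{\bar B}=\bar B^+$. Periodicity is used in $x_2$. Velocity boundary: standing assumption that $V_{1,c},V_{2,c}$ are so large that all numerical distribution functions vanish on the boundary of $\Omega_{v_1}\times\Omega_{v_2}$ and the velocity fluxes there are zero. Scheme-5$(\tau)=$ Scheme-a$(\tau/2)$ Scheme-b$(\tau/2)$ Scheme-c$(\tau)$ Scheme-b$(\tau/2)$ Scheme-a$(\tau/2)$ (composition). Scheme-5F$(\tau)=$ Scheme-5$(\beta_1\tau)$ Scheme-5$(\beta_2\tau)$ Scheme-5$(\beta_3\tau)$, $\beta_1=\beta_3=(2+2^{1/3}+2^{-1/3})/3$, $\beta_2=1-2\beta_1<0$. *)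

(* Defs.v *)
From HB Require Import structures.
From mathcomp Require Import all_boot all_order all_algebra.
From mathcomp Require Import all_classical all_reals all_analysis.
Set Implicit Arguments.
Unset Strict Implicit.
Unset Printing Implicit Defensive.
Import Order.TTheory GRing.Theory Num.Theory.
Import numFieldNormedType.Exports.
Local Open Scope classical_set_scope.
Local Open Scope ring_scope.

Record mesh (R : realType) (a b : R) := Mesh {
  ncell : nat;
  node : nat -> R;
  node_first : node 0%N = a;
  node_last : node ncell = b;
  node_lt : forall i, (i < ncell)%N -> node i < node i.+1
}.

Definition cell_l (R : realType) (a b : R) (M : mesh a b) (i : 'I_(ncell M)) : R :=
  node M i.
Definition cell_r (R : realType) (a b : R) (M : mesh a b) (i : 'I_(ncell M)) : R :=
  node M i.+1.

Definition cell_int (R : realType) (a b : R) (M : mesh a b) (i : 'I_(ncell M))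
    (u : R -> R) : R :=
  \int[lebesgue_measure]_(x in `[cell_l i, cell_r i]) u x.

(* Rodrigues' formula. *)
Definition legendre (R : realType) (n : nat) : {poly R} :=
  ((2 ^+ n * n`!%:R)^-1 : R) *: derivn n (('X^2 - 1) ^+ n).

(* The k+1 Gauss points of [-1, 1]: all the roots of the Legendre polynomial
   of degree k+1, in increasing order. *)
Definition gauss_nodes (R : realType) (k : nat) (xi : 'I_k.+1 -> R) : Prop :=
  (forall l, root (legendre R k.+1) (xi l)) /\
  (forall l m : 'I_k.+1, (l < m)%N -> xi l < xi m).

Definition gauss_pt (R : realType) (k : nat) (xi : 'I_k.+1 -> R)
    (a b : R) (M : mesh a b) (i : 'I_(ncell M)) (l : 'I_k.+1) : R :=
  (cell_l i + cell_r i) / 2 + (cell_r i - cell_l i) / 2 * xi l.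

Definition is_Pk (R : realType) (k : nat) (u : R -> R) : Prop :=
  exists c : 'I_k.+1 -> R, forall x, u x = \sum_i c i * x ^+ i.

Definition is_Qk2 (R : realType) (k : nat) (u : R -> R -> R) : Prop :=
  exists c : 'I_k.+1 -> 'I_k.+1 -> R,
    forall x y, u x y = \sum_i \sum_j c i j * x ^+ i * y ^+ j.

Definition is_Qk3 (R : realType) (k : nat) (u : R -> R -> R -> R) : Prop :=
  exists c : 'I_k.+1 -> 'I_k.+1 -> 'I_k.+1 -> R,
    forall x y z,
      u x y z = \sum_i \sum_j \sum_m c i j m * x ^+ i * y ^+ j * z ^+ m.

(* A piecewise function on a mesh is the family, indexed by the cells, of the
   functions it restricts to on each (closed) cell; for piecewise polynomials,
   each member of the family is the polynomial itself, so that a one-sided limit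
   at an interface is the value there of the polynomial of the cell on that
   side. *)

(* Numerical fluxes [F u^- u^+] at the right and left interfaces of cell [i];
   [ordS] and [ord_pred] are cyclic, which gives periodicity. *)
Definition flux_r (R : realType) (a b : R) (M : mesh a b) (F : R -> R -> R)
    (u : 'I_(ncell M) -> R -> R) (i : 'I_(ncell M)) : R :=
  F (u i (cell_r i)) (u (ordS i) (cell_l (ordS i))).
Definition flux_l (R : realType) (a b : R) (M : mesh a b) (F : R -> R -> R)
    (u : 'I_(ncell M) -> R -> R) (i : 'I_(ncell M)) : R :=
  F (u (ord_pred i) (cell_r (ord_pred i))) (u i (cell_l i)).

(* The same, but with zero flux at the two ends of the interval (velocity
   boundary condition). *)
Definition flux0_r (R : realType) (a b : R) (M : mesh a b) (F : R -> R -> R)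
    (u : 'I_(ncell M) -> R -> R) (i : 'I_(ncell M)) : R :=
  if i.+1 == ncell M then 0 else flux_r F u i.
Definition flux0_l (R : realType) (a b : R) (M : mesh a b) (F : R -> R -> R)
    (u : 'I_(ncell M) -> R -> R) (i : 'I_(ncell M)) : R :=
  if i == 0 :> nat then 0 else flux_l F u i.

Variant vlasov_flux := VCentral | VUpwind.

(* Step size [tau], advection speed [a] normal to the interface, left and right
   limits [um] and [up]; upwind turns into downwind when [tau < 0]. *)
Definition vflux (R : realType) (vf : vlasov_flux) (tau a um up : R) : R :=
  match vf with
  | VCentral => (um + up) / 2
  | VUpwind =>
      if tau < 0 then (if 0 <= a then up else um)
      else (if 0 <= a then um else up)
  end.

(* [MPlusMinus] takes E^+ and B^-, [MMinusPlus] takes E^- and B^+. *)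
Variant maxwell_flux := MCentral | MPlusMinus | MMinusPlus.

Definition mflux_E (R : realType) (mf : maxwell_flux) (um up : R) : R :=
  match mf with
  | MCentral => (up + um) / 2
  | MPlusMinus => up
  | MMinusPlus => um
  end.
Definition mflux_B (R : realType) (mf : maxwell_flux) (um up : R) : R :=
  match mf with
  | MCentral => (up + um) / 2
  | MPlusMinus => um
  | MMinusPlus => up
  end.

Section Schemes.
Variables (R : realType) (k : nat) (L V1c V2c : R).
Variables (Mx : mesh 0 L) (M1 : mesh (- V1c) V1c) (M2 : mesh (- V2c) V2c).
Variable xi : 'I_k.+1 -> R.
Variables (vf : vlasov_flux) (mf : maxwell_flux).

Definition pw_x := 'I_(ncell Mx) -> R -> R.
Definition pw_v := 'I_(ncell M1) -> 'I_(ncell M2) -> R -> R -> R.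
Definition pw_xv :=
  'I_(ncell Mx) -> 'I_(ncell M1) -> 'I_(ncell M2) -> R -> R -> R -> R.

Definition W_h (u : pw_x) : Prop := forall i, is_Pk k (u i).
Definition Z_h (g : pw_v) : Prop := forall j1 j2, is_Qk2 k (g j1 j2).
Definition S_h (f : pw_xv) : Prop := forall i j1 j2, is_Qk3 k (f i j1 j2).

Record state := State { sf : pw_xv; sE1 : pw_x; sE2 : pw_x; sB3 : pw_x }.

Definition in_spaces (s : state) : Prop :=
  [/\ S_h (sf s), W_h (sE1 s), W_h (sE2 s) & W_h (sB3 s)].

Definition xpt (i : 'I_(ncell Mx)) (l : 'I_k.+1) : R := gauss_pt xi i l.
Definition v1pt (j1 : 'I_(ncell M1)) (m1 : 'I_k.+1) : R := gauss_pt xi j1 m1.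
Definition v2pt (j2 : 'I_(ncell M2)) (m2 : 'I_k.+1) : R := gauss_pt xi j2 m2.

(* f(x_{2,i}^{(l)}, ., .) *)
Definition slice (f : pw_xv) (i : 'I_(ncell Mx)) (l : 'I_k.+1) : pw_v :=
  fun j1 j2 v1 v2 => f i j1 j2 (xpt i l) v1 v2.

Definition scheme_a (tau : R) (s s' : state) : Prop :=
  in_spaces s' /\
  sE1 s' = sE1 s /\ sE2 s' = sE2 s /\ sB3 s' = sB3 s /\
  forall j1 j2 m1 m2, exists g : pw_x,
    let fn : pw_x := fun i x => sf s i j1 j2 x (v1pt j1 m1) (v2pt j2 m2) in
    let gbar : pw_x := fun i x => (g i x + fn i x) / 2 in
    let a := v2pt j2 m2 in
    [/\ W_h g,
        forall (i : 'I_(ncell Mx)) (phi : pw_x), W_h phi ->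
          cell_int i (fun x => (g i x - fn i x) / tau * phi i x)
          - cell_int i (fun x => a * gbar i x * derive1 (phi i) x)
          + a * flux_r (vflux vf tau a) gbar i * phi i (cell_r i)
          - a * flux_l (vflux vf tau a) gbar i * phi i (cell_l i) = 0
      & forall i l, sf s' i j1 j2 (xpt i l) (v1pt j1 m1) (v2pt j2 m2)
                    = g i (xpt i l)].

(* The form D_{j1,j2}(g; a1, a2; phi), with a1 a function of v2 and a2 a
   function of v1. *)
Definition Dform (tau : R) (g : pw_v) (a1 a2 : R -> R) (phi : pw_v)
    (j1 : 'I_(ncell M1)) (j2 : 'I_(ncell M2)) : R :=
  - cell_int j2 (fun v2 => cell_int j1 (fun v1 =>
      g j1 j2 v1 v2 *
      (a1 v2 * derive1 (fun w1 => phi j1 j2 w1 v2) v1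
       + a2 v1 * derive1 (fun w2 => phi j1 j2 v1 w2) v2)))
  + cell_int j2 (fun v2 =>
      let g1 := fun j v1 => g j j2 v1 v2 in
      a1 v2 *
      (flux0_r (vflux vf tau (a1 v2)) g1 j1 * phi j1 j2 (cell_r j1) v2
       - flux0_l (vflux vf tau (a1 v2)) g1 j1 * phi j1 j2 (cell_l j1) v2))
  + cell_int j1 (fun v1 =>
      let g2 := fun j v2 => g j1 j v1 v2 in
      a2 v1 *
      (flux0_r (vflux vf tau (a2 v1)) g2 j2 * phi j1 j2 v1 (cell_r j2)
       - flux0_l (vflux vf tau (a2 v1)) g2 j2 * phi j1 j2 v1 (cell_l j2))).

Definition midv (g h : pw_v) : pw_v :=
  fun j1 j2 v1 v2 => (g j1 j2 v1 v2 + h j1 j2 v1 v2) / 2.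

Definition v_int (h : pw_v) : R :=
  \sum_j2 \sum_j1 cell_int j2 (fun v2 => cell_int j1 (fun v1 => h j1 j2 v1 v2)).
Definition current1 (g : pw_v) : R := v_int (fun j1 j2 v1 v2 => g j1 j2 v1 v2 * v1).
Definition current2 (g : pw_v) : R := v_int (fun j1 j2 v1 v2 => g j1 j2 v1 v2 * v2).

Definition scheme_b (tau : R) (s s' : state) : Prop :=
  in_spaces s' /\
  sB3 s' = sB3 s /\
  forall i l, exists (g : pw_v) (e1 e2 : R),
    let fn := slice (sf s) i l in
    let e1n := sE1 s i (xpt i l) in
    let e2n := sE2 s i (xpt i l) in
    [/\ Z_h g,
        forall j1 j2 (phi : pw_v), Z_h phi ->
          cell_int j2 (fun v2 => cell_int j1 (fun v1 =>
            (g j1 j2 v1 v2 - fn j1 j2 v1 v2) / tau * phi j1 j2 v1 v2))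
          + Dform tau (midv g fn) (fun=> (e1n + e1) / 2) (fun=> (e2n + e2) / 2)
              phi j1 j2 = 0,
        (e1 - e1n) / tau = - ((current1 fn + current1 g) / 2) /\
        (e2 - e2n) / tau = - ((current2 fn + current2 g) / 2),
        forall j1 j2 m1 m2,
          sf s' i j1 j2 (xpt i l) (v1pt j1 m1) (v2pt j2 m2)
          = g j1 j2 (v1pt j1 m1) (v2pt j2 m2)
      & sE1 s' i (xpt i l) = e1 /\ sE2 s' i (xpt i l) = e2].

Definition scheme_c (tau : R) (s s' : state) : Prop :=
  in_spaces s' /\
  sE2 s' = sE2 s /\
  let Ebar : pw_x := fun i x => (sE1 s' i x + sE1 s i x) / 2 in
  let Bbar : pw_x := fun i x => (sB3 s' i x + sB3 s i x) / 2 in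
  [/\ forall (i : 'I_(ncell Mx)) (phi : pw_x), W_h phi ->
        cell_int i (fun x => (sE1 s' i x - sE1 s i x) / tau * phi i x)
        = - cell_int i (fun x => Bbar i x * derive1 (phi i) x)
          + flux_r (mflux_B mf) Bbar i * phi i (cell_r i)
          - flux_l (mflux_B mf) Bbar i * phi i (cell_l i),
      forall (i : 'I_(ncell Mx)) (phi : pw_x), W_h phi ->
        cell_int i (fun x => (sB3 s' i x - sB3 s i x) / tau * phi i x)
        = - cell_int i (fun x => Ebar i x * derive1 (phi i) x)
          + flux_r (mflux_E mf) Ebar i * phi i (cell_r i)
          - flux_l (mflux_E mf) Ebar i * phi i (cell_l i)
    & forall i l, exists g : pw_v,
        let fn := slice (sf s) i l in
        let b := Bbar i (xpt i l) in
        [/\ Z_h g,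
            forall j1 j2 (phi : pw_v), Z_h phi ->
              cell_int j1 (fun v1 => cell_int j2 (fun v2 =>
                (g j1 j2 v1 v2 - fn j1 j2 v1 v2) / tau * phi j1 j2 v1 v2))
              + Dform tau (midv g fn) (fun v2 => v2 * b) (fun v1 => - v1 * b)
                  phi j1 j2 = 0
          & forall j1 j2 m1 m2,
              sf s' i j1 j2 (xpt i l) (v1pt j1 m1) (v2pt j2 m2)
              = g j1 j2 (v1pt j1 m1) (v2pt j2 m2)]].

Definition scheme_5 (tau : R) (s s' : state) : Prop :=
  exists s1 s2 s3 s4 : state,
    scheme_a (tau / 2) s s1 /\
    scheme_b (tau / 2) s1 s2 /\
    scheme_c tau s2 s3 /\
    scheme_b (tau / 2) s3 s4 /\
    scheme_a (tau / 2) s4 s'.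

Definition beta1 : R := (2 + 2 `^ 3^-1 + 2 `^ (- 3^-1)) / 3.
Definition beta2 : R := 1 - 2 * beta1.
Definition beta3 : R := beta1.

Definition scheme_5F (tau : R) (s s' : state) : Prop :=
  exists s1 s2 : state,
    scheme_5 (beta1 * tau) s s1 /\
    scheme_5 (beta2 * tau) s1 s2 /\
    scheme_5 (beta3 * tau) s2 s'.

Definition total_energy (s : state) : R :=
  (\sum_i \sum_j2 \sum_j1
     cell_int i (fun x => cell_int j2 (fun v2 => cell_int j1 (fun v1 =>
       sf s i j1 j2 x v1 v2 * (v1 ^+ 2 + v2 ^+ 2))))
   + \sum_i cell_int i (fun x =>
       `|sE1 s i x| ^+ 2 + `|sE2 s i x| ^+ 2 + `|sB3 s i x| ^+ 2)) / 2.

End Schemes.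

(* Main.v *)
(* Gauss quadrature with k+1 points is exact up to degree 2k+1, so the total
   energy is a quadrature sum, over the points of the x-cells, of a kinetic
   energy in velocity and the squares of the fields.  Each substep conserves it:
   - Scheme-a conserves the mass carried by every fixed velocity node (test
     function 1, periodic fluxes telescope);
   - in Scheme-b and Scheme-c, |v|^2 is an admissible continuous test function
     because k >= 2, so the velocity fluxes telescope and the kinetic energy
     changes by twice the work of the mean field against the mean current.  In
     Scheme-b the midpoint rule turns that work into minus the change of E^2;
     in Scheme-c the magnetic force (v2 B, -v1 B) does no work;
   - in Scheme-c, testing Maxwell's equations with the mean fields leaves, at
     each interface, a combination of jumps that vanishes for the central and
     the alternating fluxes. *)
Require Import Defs.
From mathcomp Require Import all_boot all_order all_algebra.
From mathcomp Require Import all_classical all_reals all_analysis.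
From mathcomp Require Import ring lra zify.
Set Implicit Arguments.
Unset Strict Implicit.
Unset Printing Implicit Defensive.
Import Order.TTheory GRing.Theory Num.Theory.
Import numFieldNormedType.Exports.
Local Open Scope ring_scope.

(** * Polynomial functions *)

Section PolynomialFunctions.
Variable R : realType.
Implicit Types (u v : R -> R) (p q : {poly R}).

(** Being equal, as a function, to the evaluation of a [{poly R}] lets degree bounds and calculus be
    inherited from polynomial algebra; [is_PkE] links this form to [is_Pk]. *)
Definition poly_deg (n : nat) u : Prop :=
  exists2 p : {poly R}, (size p <= n.+1)%N & u = horner p.

Lemma poly_deg_horner n p : (size p <= n.+1)%N -> poly_deg n (horner p).
Proof. by exists p. Qed.

Lemma poly_deg_leq m n u : (m <= n)%N -> poly_deg m u -> poly_deg n u.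
Proof. by move=> mn [p sp ->]; exists p => //; apply: leq_trans sp _. Qed.

Lemma poly_deg_cst n (c : R) : poly_deg n (fun=> c).
Proof.
exists c%:P; first by rewrite size_polyC; case: (c != 0).
by apply/funext => x; rewrite hornerC.
Qed.

Lemma poly_deg_id n : poly_deg n.+1 (fun x : R => x).
Proof.
exists 'X; first by rewrite size_polyX.
by apply/funext => x; rewrite hornerX.
Qed.

Lemma poly_degD n u v :
  poly_deg n u -> poly_deg n v -> poly_deg n (fun x => u x + v x).
Proof.
move=> [p sp ->] [q sq ->]; exists (p + q).
  by rewrite (leq_trans (size_polyD _ _))// geq_max sp.
by apply/funext => x; rewrite hornerD.
Qed.

Lemma poly_degM m n u v :
  poly_deg m u -> poly_deg n v -> poly_deg (m + n) (fun x => u x * v x).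
Proof.
move=> [p sp ->] [q sq ->]; exists (p * q).
  by rewrite (leq_trans (size_polyMleq _ _))//; lia.
by apply/funext => x; rewrite hornerM.
Qed.

Lemma poly_degZ n c u : poly_deg n u -> poly_deg n (fun x => c * u x).
Proof. exact/(@poly_degM 0)/poly_deg_cst. Qed.

Lemma poly_degZr n c u : poly_deg n u -> poly_deg n (fun x => u x * c).
Proof. by move/(poly_degZ c); under eq_fun do rewrite mulrC. Qed.

Lemma poly_degB n u v :
  poly_deg n u -> poly_deg n v -> poly_deg n (fun x => u x - v x).
Proof.
move=> nu nv; apply: poly_degD => //.
by under eq_fun do rewrite -mulN1r; apply: poly_degZ.
Qed.

Lemma poly_degX n : poly_deg n (fun x : R => x ^+ n).
Proof.
exists 'X^n; first by rewrite size_polyXn.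
by apply/funext => x; rewrite hornerXn.
Qed.

Lemma poly_deg_sum (I : Type) (r : seq I) n (U : I -> R -> R) :
  (forall i, poly_deg n (U i)) -> poly_deg n (fun x => \sum_(i <- r) U i x).
Proof.
move=> nU; elim: r => [|i r IHr].
  by under eq_fun do rewrite big_nil; apply: poly_deg_cst.
by under eq_fun do rewrite big_cons; apply: poly_degD.
Qed.

Lemma is_PkE n u : is_Pk n u <-> poly_deg n u.
Proof.
split=> [[c uE]|[p sp ->]].
  have -> : u = fun x => \sum_(i < n.+1) c i * x ^+ i by apply/funext.
  apply: poly_deg_sum => i; apply: poly_degZ; apply: poly_deg_leq (poly_degX i).
  by rewrite -ltnS.
exists (fun i => p`_i) => x; rewrite (horner_coef_wide _ sp).
by apply: eq_bigr => i _.
Qed.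

Lemma size_deriv_leq p : (size p^`() <= (size p).-1)%N.
Proof. exact: size_poly. Qed.

Lemma poly_deg_derive1 n u : poly_deg n u -> poly_deg n.-1 (derive1 u).
Proof.
move=> [p sp ->]; rewrite -derivE; apply: poly_deg_horner.
by rewrite (leq_trans (size_deriv_leq p))//; lia.
Qed.

Lemma poly_deg_continuous n u : poly_deg n u -> continuous u.
Proof. by move=> [p _ ->] x; apply: continuous_horner. Qed.

Lemma derive1M_poly n m u v x : poly_deg n u -> poly_deg m v ->
  derive1 (fun x => u x * v x) x = u x * derive1 v x + v x * derive1 u x.
Proof.
move=> [p _ ->] [q _ ->].
have -> : (fun x => p.[x] * q.[x]) = horner (p * q).
  by apply/funext => y; rewrite hornerM.
by rewrite -!derivE derivM hornerD !hornerM; ring.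
Qed.

Lemma continuous_Rintegrable (a b : R) u : continuous u ->
  (@lebesgue_measure R).-integrable `[a, b]%classic (EFin \o u).
Proof.
move=> cu; apply: continuous_compact_integrable; first exact: segment_compact.
exact: continuous_subspaceT.
Qed.

Lemma continuous_sumr (I : Type) (r : seq I) (U : I -> R -> R) :
  (forall i, continuous (U i)) -> continuous (fun x => \sum_(i <- r) U i x).
Proof.
move=> cU; elim: r => [|i r IHr].
  by under eq_fun do rewrite big_nil; move=> x; apply: cvg_cst.
under eq_fun do rewrite big_cons.
by move=> x; apply: cvgD; [exact: cU|exact: IHr].
Qed.

Lemma Rintegral_sum (I : Type) (r : seq I) (a b : R) (U : I -> R -> R) :
  (forall i, continuous (U i)) ->
  \int[lebesgue_measure]_(x in `[a, b]) (\sum_(i <- r) U i x) =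
  \sum_(i <- r) \int[lebesgue_measure]_(x in `[a, b]) U i x.
Proof.
move=> cU; elim: r => [|i r IHr].
  under eq_Rintegral do rewrite big_nil.
  by rewrite Rintegral_cst// mul0r big_nil.
under eq_Rintegral do rewrite big_cons.
rewrite RintegralD ?IHr ?big_cons //; apply: continuous_Rintegrable => //.
exact: continuous_sumr.
Qed.

Lemma Rintegral_deriv (a b : R) p : a < b ->
  \int[lebesgue_measure]_(x in `[a, b]) (p^`()).[x] = p.[b] - p.[a].
Proof.
move=> ab; rewrite /Rintegral (@continuous_FTC2 _ _ (horner p)) //.
- by apply: continuous_subspaceT => x; apply: continuous_horner.
- split=> [x _||]; first exact: derivable_horner.
  + by apply: cvg_at_right_filter; apply: continuous_horner.
  + by apply: cvg_at_left_filter; apply: continuous_horner.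
- by move=> x _; rewrite derivE.
Qed.

Lemma Rintegral_derive1 n (a b : R) u : a < b -> poly_deg n u ->
  \int[lebesgue_measure]_(x in `[a, b]) derive1 u x = u b - u a.
Proof.
by move=> ab [p _ ->]; rewrite -derivE Rintegral_deriv.
Qed.

Lemma antiderivative p :
  exists2 P : {poly R}, P^`() = p & (size P <= (size p).+1)%N.
Proof.
(* The constant coefficient is a division by zero, which is 0 by convention; the derivative does not
   see it. *)
exists (\poly_(i < (size p).+1) (p`_i.-1 / i%:R)); last exact: size_poly.
apply/polyP => i; rewrite coef_deriv coef_poly ltnS.
case: ltnP => [_|sp]; last by rewrite mul0rn nth_default.
by rewrite -[LHS]mulr_natr divfK// pnatr_eq0.
Qed.

End PolynomialFunctions.

(** * Gauss quadrature *)

Section GaussQuadrature.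
Variable R : realType.
Implicit Types p q : {poly R}.

Definition int11 p : R := \int[lebesgue_measure]_(x in `[-1, 1]) p.[x].

Lemma int11_deriv p : int11 p^`() = p.[1] - p.[-1].
Proof. by apply: Rintegral_deriv; lra. Qed.

(** Through antiderivatives, additivity of the integral becomes additivity of evaluation at the
    endpoints. *)
Lemma int11D p q : int11 (p + q) = int11 p + int11 q.
Proof.
have [P <- _] := antiderivative p; have [Q <- _] := antiderivative q.
rewrite -derivD !int11_deriv !hornerD; ring.
Qed.

Lemma int11Z c p : int11 (c *: p) = c * int11 p.
Proof.
have [P <- _] := antiderivative p.
rewrite -derivZ !int11_deriv !hornerZ; ring.
Qed.

Lemma int11_sum (I : Type) (r : seq I) (F : I -> {poly R}) :
  int11 (\sum_(i <- r) F i) = \sum_(i <- r) int11 (F i).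
Proof.
elim: r => [|i r IHr]; last by rewrite !big_cons int11D IHr.
by rewrite !big_nil -(scale0r 0) int11Z mul0r.
Qed.

Lemma int11_by_parts p q : (p * q).[1] = 0 -> (p * q).[-1] = 0 ->
  int11 (p * q^`()) = - int11 (p^`() * q).
Proof.
move=> h1 hN1; apply/eqP; rewrite -addr_eq0 -int11D addrC -derivM int11_deriv.
by rewrite h1 hN1 subrr.
Qed.

(** * Legendre polynomials: orthogonality and degree *)

Lemma dvdp_XsubC_deriv (c : R) n p :
  ('X - c%:P) ^+ n.+1 %| p -> ('X - c%:P) ^+ n %| p^`().
Proof.
move=> /dvdpP [q ->]; rewrite derivM deriv_exp derivXsubC mul1r /=.
apply: dvdp_add; first by rewrite dvdp_mull// exprS dvdp_mulIr.
by rewrite -mulr_natr mulrCA dvdp_mulIl.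
Qed.

Lemma dvdp_XsubC_derivn (c : R) n m p :
  ('X - c%:P) ^+ (m + n) %| p -> ('X - c%:P) ^+ n %| p^`(m).
Proof.
elim: m n => [|m IHm] n //; rewrite addSnnS => /IHm.
by rewrite derivnS; apply: dvdp_XsubC_deriv.
Qed.

(** Both 1 and -1 are zeros of order n of (X^2 - 1)^n, and each derivative lowers the order by at
    most one. *)
Lemma rodrigues_boundary n m (c : R) : (m < n)%N -> c ^+ 2 = 1 ->
  (('X^2 - 1) ^+ n : {poly R})^`(m).[c] = 0.
Proof.
move=> mn c2; apply/rootP; rewrite -dvdp_XsubCl.
apply: dvdp_XsubC_derivn (_ : is_true (_ ^+ (m + 1) %| _)); rewrite addn1.
apply: dvdp_trans (_ : _ %| ('X - c%:P) ^+ n) _; first exact: dvdp_exp2l.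
apply: dvdp_exp2r; rewrite dvdp_XsubCl /root !hornerE.
by rewrite c2 subrr.
Qed.

(** Each integration by parts moves one derivative onto [q], without boundary terms; [m] of them
    annihilate [q], whose degree is below [m]. *)
Lemma rodrigues_orthogonal n m q : (size q <= m)%N -> (m <= n)%N ->
  int11 (q * (('X^2 - 1) ^+ n)^`(m)) = 0.
Proof.
elim: m q => [|m IHm] q sq mn.
  move: sq; rewrite leqn0 size_poly_eq0 => /eqP->.
  by rewrite mul0r -(scale0r 0) int11Z mul0r.
rewrite derivnS int11_by_parts ?hornerM ?rodrigues_boundary ?mulr0 ?expr1n//.
- rewrite IHm ?oppr0//; last exact: ltnW.
  by rewrite (leq_trans (size_deriv_leq q))//; lia.
- by rewrite sqrrN expr1n.
Qed.

Lemma size_legendre n : size (legendre R n) = n.+1.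
Proof.
have mon : ('X^2 - 1 : {poly R}) \is monic by apply: monicXnsubC.
rewrite size_scale; last first.
  by rewrite invr_eq0 mulf_neq0// ?expf_neq0// pnatr_eq0 ?fact_gt0 -?lt0n ?fact_gt0.
set u := (_ ^+ n : {poly R}).
have su : size u = (n + n).+1.
  have := size_exp ('X^2 - 1 : {poly R}) n.
  rewrite (@size_XnsubC _ 2)// -/u => h.
  have u0 : u != 0 by rewrite expf_neq0// monic_neq0.
  by rewrite -(@prednK (size u)) ?size_poly_gt0// h mul2n addnn.
have lu : u`_(n + n) = 1.
  have /monicP : u \is monic by apply: monic_exp.
  by rewrite /lead_coef su.
apply/eqP; rewrite eqn_leq; apply/andP; split.
  apply/leq_sizeP => j nj; rewrite coef_derivn nth_default ?mul0rn//.
  by rewrite su; lia.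
(* The coefficient of degree n is the falling factorial of 2n with n factors, nonzero in
   characteristic 0. *)
rewrite ltnNge; apply/negP => /leq_sizeP /(_ n (leqnn n)).
rewrite coef_derivn lu; apply/eqP; rewrite pnatr_eq0 -lt0n ffact_gt0.
exact: leq_addr.
Qed.

Lemma legendre_orthogonal n q : (size q <= n)%N ->
  int11 (q * legendre R n) = 0.
Proof.
by move=> sq; rewrite /legendre -scalerAr int11Z rodrigues_orthogonal ?mulr0.
Qed.

(** * Lagrange interpolation and exactness of the Gauss rule *)

Variables (k : nat) (xi : 'I_k.+1 -> R).
Hypothesis xiP : gauss_nodes xi.

Definition lagrange_basis (l : 'I_k.+1) : {poly R} :=
  \prod_(m < k.+1 | m != l) ((xi l - xi m)^-1 *: ('X - (xi m)%:P)).

Definition gauss_weight (l : 'I_k.+1) : R := int11 (lagrange_basis l).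

Lemma gauss_nodes_inj : injective xi.
Proof.
have [_ incr] := xiP; move=> l m e; apply/val_inj/eqP.
by case: ltngtP => // /incr; rewrite e ltxx.
Qed.

Lemma lagrange_basisE l m : (lagrange_basis l).[xi m] = (l == m)%:R.
Proof.
rewrite horner_prod; have [<-|lm] := eqVneq l m.
  rewrite big1// => j jl; rewrite !hornerE mulVf// subr_eq0.
  by apply: contraNneq jl => /gauss_nodes_inj ->.
by rewrite (bigD1 m) 1?eq_sym//= !hornerE subrr mulr0 mul0r.
Qed.

Lemma size_lagrange_basis l : (size (lagrange_basis l) <= k.+1)%N.
Proof.
rewrite /lagrange_basis; apply: leq_trans (size_poly_prod_leq _ _) _.
have -> : #|(fun m : 'I_k.+1 => m != l)| = k.
  by rewrite -[RHS](_ : #|predC1 l| = k)// cardC1 card_ord.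
rewrite leq_subLR addnS ltnS.
apply: (@leq_trans (\sum_(m < k.+1 | m != l) 2)).
  apply: leq_sum => m _.
  by rewrite (leq_trans (size_scale_leq _ _))// size_XsubC.
by rewrite sum_nat_const cardC1 card_ord muln2 addnn.
Qed.

(** The difference of the two sides has degree at most [k] and vanishes at k+1 distinct nodes. *)
Lemma lagrange_interpolation p : (size p <= k.+1)%N ->
  p = \sum_l p.[xi l] *: lagrange_basis l.
Proof.
move=> sp; apply/eqP; rewrite -subr_eq0; apply/negPn/negP => nz.
have := max_poly_roots nz (_ : all _ [seq xi l | l : 'I_k.+1]).
rewrite size_map size_enum_ord map_inj_uniq ?enum_uniq;
  last exact: gauss_nodes_inj.
move=> /(_ _ isT); set d := p - _ => h.
have : (k.+1 < size d)%N.
  apply: h; apply/allP => _ /mapP[m _ ->].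
  rewrite /root hornerD hornerN horner_sum (bigD1 m)//= big1 ?addr0.
    by rewrite hornerZ lagrange_basisE eqxx mulr1 subrr.
  by move=> l /negPf lm; rewrite hornerZ lagrange_basisE lm mulr0.
rewrite ltnNge => /negP; apply.
rewrite (leq_trans (size_polyD _ _))// geq_max sp size_polyN.
apply: leq_trans (size_sum _ _ _) _; apply/bigmax_leqP => l _.
exact: leq_trans (size_scale_leq _ _) (size_lagrange_basis l).
Qed.

(** Divide [p] by the Legendre polynomial of degree k+1. The quotient has degree at most [k], so its
    part integrates to 0 by orthogonality; that part also vanishes at the nodes, so only the
    remainder counts, and it is interpolated exactly. *)
Lemma gauss_quadrature11 p : (size p <= k.*2.+2)%N ->
  int11 p = \sum_l gauss_weight l * p.[xi l].
Proof.
move=> sp; have [roots _] := xiP.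
set P := legendre R k.+1.
have P0 : P != 0 by rewrite -size_poly_gt0 size_legendre.
have sr : (size (p %% P)%R <= k.+1)%N.
  by rewrite -ltnS -(size_legendre k.+1) ltn_modp.
have sq : (size (p %/ P)%R <= k.+1)%N.
  by rewrite size_divp// size_legendre leq_subLR /= addnn doubleS.
rewrite {1}(divp_eq p P) int11D legendre_orthogonal// add0r.
rewrite {1}(lagrange_interpolation sr) int11_sum; apply: eq_bigr => l _.
rewrite int11Z mulrC; congr (_ * _).
by rewrite {2}(divp_eq p P) hornerD hornerM (rootP (roots l)) mulr0 add0r.
Qed.

Definition cell_weight (a b : R) (M : mesh a b) (i : 'I_(ncell M))
    (l : 'I_k.+1) : R := (cell_r i - cell_l i) / 2 * gauss_weight l.

Lemma cell_lr (a b : R) (M : mesh a b) (i : 'I_(ncell M)) :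
  cell_l i < cell_r i.
Proof. exact: node_lt. Qed.

Lemma gauss_quadrature (a b : R) (M : mesh a b) (i : 'I_(ncell M)) u :
  poly_deg k.*2.+1 u ->
  cell_int i u = \sum_l cell_weight i l * u (gauss_pt xi i l).
Proof.
move=> [p sp ->]; have [P Pp _] := antiderivative p.
pose c := (cell_l i + cell_r i) / 2; pose d := (cell_r i - cell_l i) / 2.
pose aff : {poly R} := d *: 'X + c%:P.
have affE x : aff.[x] = c + d * x by rewrite !hornerE addrC.
(* The affine change of variables is read off antiderivatives: both integrals are the increment of
   [P] between the endpoints of the cell. *)
have -> : cell_int i (horner p) = int11 (P \Po aff)^`().
  rewrite int11_deriv !horner_comp !affE /cell_int -Pp.
  rewrite Rintegral_deriv ?cell_lr//.
  by congr (_.[_] - _.[_]); rewrite /c /d; field.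
rewrite deriv_comp Pp derivD derivZ derivX derivC addr0.
rewrite -scalerAr mulr1 int11Z gauss_quadrature11; last first.
  have saff : ((size aff).-1 <= 1)%N.
    rewrite -subn1 leq_subLR (leq_trans (size_polyD _ _))// geq_max.
    rewrite (leq_trans (size_scale_leq _ _)) ?size_polyX// size_polyC.
    by case: (_ != _).
  apply: leq_trans (size_comp_poly_leq _ _) _; rewrite ltnS.
  apply: leq_trans (leq_mul (leqnn _) saff) _.
  by rewrite muln1 -subn1 leq_subLR.
rewrite mulr_sumr; apply: eq_bigr => l _.
by rewrite /cell_weight mulrA horner_comp affE.
Qed.

End GaussQuadrature.

(** * Integration over velocity cells *)

Section SeparatePolynomials.
Variable R : realType.

(** Bounds the degree in each variable separately, which is stable under products and is what
    iterated one-dimensional quadrature uses. *)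
Definition poly_deg2 (n : nat) (h : R -> R -> R) : Prop :=
  (forall y, poly_deg n (h^~ y)) /\ (forall x, poly_deg n (h x)).

Lemma poly_deg2_leq m n h : (m <= n)%N -> poly_deg2 m h -> poly_deg2 n h.
Proof. by move=> mn [h1 h2]; split=> z; apply: poly_deg_leq mn _. Qed.

Lemma poly_deg2D n h1 h2 : poly_deg2 n h1 -> poly_deg2 n h2 ->
  poly_deg2 n (fun x y => h1 x y + h2 x y).
Proof. by move=> [a b] [c d]; split=> z; apply: poly_degD. Qed.

Lemma poly_deg2B n h1 h2 : poly_deg2 n h1 -> poly_deg2 n h2 ->
  poly_deg2 n (fun x y => h1 x y - h2 x y).
Proof. by move=> [a b] [c d]; split=> z; apply: poly_degB. Qed.

Lemma poly_deg2M m n h1 h2 : poly_deg2 m h1 -> poly_deg2 n h2 ->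
  poly_deg2 (m + n) (fun x y => h1 x y * h2 x y).
Proof. by move=> [a b] [c d]; split=> z; apply: poly_degM. Qed.

Lemma poly_deg2Z n c h : poly_deg2 n h -> poly_deg2 n (fun x y => c * h x y).
Proof. by move=> [a b]; split=> z; apply: poly_degZ. Qed.

Lemma poly_deg2Zr n c h : poly_deg2 n h -> poly_deg2 n (fun x y => h x y * c).
Proof. by move=> [a b]; split=> z; apply: poly_degZr. Qed.

Lemma poly_deg2_fst n (u : R -> R) : poly_deg n u -> poly_deg2 n (fun x _ => u x).
Proof. by move=> nu; split=> z //; apply: poly_deg_cst. Qed.

Lemma poly_deg2_snd n (u : R -> R) : poly_deg n u -> poly_deg2 n (fun _ y => u y).
Proof. by move=> nu; split=> z //; apply: poly_deg_cst. Qed.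

Lemma is_Qk2_poly_deg2 n (h : R -> R -> R) : is_Qk2 n h -> poly_deg2 n h.
Proof.
move=> [c hE]; have -> : h = fun x y => \sum_i \sum_j c i j * x ^+ i * y ^+ j.
  by apply/funext => x; apply/funext => y.
split=> z; apply: poly_deg_sum => i; apply: poly_deg_sum => j.
  apply/poly_degZr/poly_degZ; apply: poly_deg_leq (poly_degX R _).
  by rewrite -ltnS.
by apply: poly_degZ; apply: poly_deg_leq (poly_degX R _); rewrite -ltnS.
Qed.

Lemma is_Qk2M n (u v : R -> R) : poly_deg n u -> poly_deg n v ->
  is_Qk2 n (fun x y => u x * v y).
Proof.
move=> /is_PkE[c uE] /is_PkE[d vE]; exists (fun i j => c i * d j) => x y.
rewrite uE vE mulr_suml; apply: eq_bigr => i _.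
by rewrite mulr_sumr; apply: eq_bigr => j _; ring.
Qed.

Lemma is_Qk2D n (h1 h2 : R -> R -> R) : is_Qk2 n h1 -> is_Qk2 n h2 ->
  is_Qk2 n (fun x y => h1 x y + h2 x y).
Proof.
move=> [c cE] [d dE]; exists (fun i j => c i j + d i j) => x y.
rewrite cE dE -big_split; apply: eq_bigr => i _ /=.
by rewrite -big_split; apply: eq_bigr => j _ /=; ring.
Qed.

Lemma is_Qk3_poly_deg n (f : R -> R -> R -> R) : is_Qk3 n f ->
  (forall y z, poly_deg n (fun x => f x y z)) /\ (forall x, is_Qk2 n (f x)).
Proof.
move=> [c fE]; split=> [y z|x].
  under eq_fun do rewrite fE.
  do 3![apply: poly_deg_sum => ?]; do 2!apply/poly_degZr.
  by apply: poly_degZ; apply: poly_deg_leq (poly_degX R _); rewrite -ltnS.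
exists (fun j m => \sum_i c i j m * x ^+ i) => y z; rewrite fE exchange_big /=.
apply: eq_bigr => j _; rewrite exchange_big /=; apply: eq_bigr => m _.
by rewrite !mulr_suml.
Qed.

(** * Tensor Gauss quadrature over velocity cells *)

Variables (k : nat) (xi : 'I_k.+1 -> R).
Hypothesis xiP : gauss_nodes xi.

Lemma gauss_quadrature2 (a b c d : R) (M1 : mesh a b) (M2 : mesh c d)
    (j1 : 'I_(ncell M1)) (j2 : 'I_(ncell M2)) h :
  poly_deg2 k.*2.+1 h ->
  cell_int j2 (fun v2 => cell_int j1 (fun v1 => h v1 v2)) =
  \sum_m2 \sum_m1 cell_weight xi j2 m2 * cell_weight xi j1 m1 *
    h (gauss_pt xi j1 m1) (gauss_pt xi j2 m2).
Proof.
move=> [h1 h2].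
have -> : (fun v2 => cell_int j1 (fun v1 => h v1 v2)) =
    fun v2 => \sum_m1 cell_weight xi j1 m1 * h (gauss_pt xi j1 m1) v2.
  by apply/funext => v2; rewrite (gauss_quadrature xiP).
rewrite (gauss_quadrature xiP); last first.
  by apply: poly_deg_sum => m; apply: poly_degZ.
apply: eq_bigr => m2 _; rewrite mulr_sumr; apply: eq_bigr => m1 _.
by rewrite mulrA.
Qed.

(** Both iterated integrals equal the same finite quadrature sum. This reconciles the orders of
    integration of Scheme-b and Scheme-c. *)
Lemma cell_int_exchange (a b c d : R) (M1 : mesh a b) (M2 : mesh c d)
    (j1 : 'I_(ncell M1)) (j2 : 'I_(ncell M2)) h :
  poly_deg2 k.*2.+1 h ->
  cell_int j1 (fun v1 => cell_int j2 (fun v2 => h v1 v2)) =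
  cell_int j2 (fun v2 => cell_int j1 (fun v1 => h v1 v2)).
Proof.
move=> [h1 h2]; rewrite [RHS]gauss_quadrature2//.
rewrite (@gauss_quadrature2 _ _ _ _ _ _ j2 j1 (fun y x => h x y))//.
rewrite exchange_big; apply: eq_bigr => m2 _; apply: eq_bigr => m1 _ /=.
by rewrite [cell_weight _ _ m1 * _]mulrC.
Qed.

Variables (V1c V2c : R) (M1 : mesh (- V1c) V1c) (M2 : mesh (- V2c) V2c).
Implicit Types h : pw_v M1 M2.

Definition pw_poly_deg2 n h := forall j1 j2, poly_deg2 n (h j1 j2).

Lemma v_int_gauss h : pw_poly_deg2 k.*2.+1 h ->
  v_int h = \sum_j2 \sum_j1 \sum_m2 \sum_m1
    cell_weight xi j2 m2 * cell_weight xi j1 m1 *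
    h j1 j2 (v1pt xi j1 m1) (v2pt xi j2 m2).
Proof.
move=> hP; apply: eq_bigr => j2 _; apply: eq_bigr => j1 _.
exact: gauss_quadrature2.
Qed.

Lemma v_intD h1 h2 : pw_poly_deg2 k.*2.+1 h1 -> pw_poly_deg2 k.*2.+1 h2 ->
  v_int (fun j1 j2 v1 v2 => h1 j1 j2 v1 v2 + h2 j1 j2 v1 v2) =
  v_int h1 + v_int h2.
Proof.
move=> h1P h2P; rewrite !v_int_gauss//; last first.
  by move=> j1 j2; apply: poly_deg2D; [exact: h1P|exact: h2P].
do 4![rewrite -big_split; apply: eq_bigr => ? _ /=].
by rewrite mulrDr.
Qed.

Lemma v_intZ c h : pw_poly_deg2 k.*2.+1 h ->
  v_int (fun j1 j2 v1 v2 => c * h j1 j2 v1 v2) = c * v_int h.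
Proof.
move=> hP; rewrite !v_int_gauss//; last first.
  by move=> j1 j2; apply: poly_deg2Z; exact: hP.
do 4![rewrite mulr_sumr; apply: eq_bigr => ? _ /=].
by rewrite mulrCA.
Qed.

End SeparatePolynomials.

(** * Numerical fluxes *)

Section Fluxes.
Variable R : realType.

Lemma big_ordS n (F : 'I_n -> R) : \sum_i F (ordS i) = \sum_i F i.
Proof.
rewrite [RHS](reindex (@ordS n))//.
by exists (@ord_pred n) => i _; [exact: ordSK|exact: ord_predK].
Qed.

Variables (a b : R) (M : mesh a b).
Implicit Types (F : R -> R -> R) (u : 'I_(ncell M) -> R -> R).

Lemma flux_l_ordS F u i : flux_l F u (ordS i) = flux_r F u i.
Proof. by rewrite /flux_l ordSK. Qed.

Lemma flux_r_sum F u : \sum_i flux_r F u i = \sum_i flux_l F u i.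
Proof.
by rewrite -[RHS]big_ordS; apply: eq_bigr => i _; rewrite flux_l_ordS.
Qed.

(** As [q] is one function on the whole interval, it has a single value at each interface, and the
    two neighbouring contributions cancel there. At the cyclic wrap-around both fluxes are 0. *)
Lemma flux0_telescope F u (q : R -> R) :
  \sum_j (flux0_r F u j * q (cell_r j) - flux0_l F u j * q (cell_l j)) = 0.
Proof.
rewrite sumrB -[X in _ - X]big_ordS -sumrB big1// => j _.
rewrite /flux0_r /flux0_l flux_l_ordS /cell_l /cell_r /=.
have [jn|jn] := eqVneq; first by rewrite jn modnn eqxx !mul0r subrr.
by rewrite modn_small ?subrr// ltn_neqAle jn ltn_ord.
Qed.

(** Central flux plus a jump term weighted by |c|: [sg] is 0 for central, 1 for upwind and -1 for
    downwind. The right side is visibly continuous in [c]. *)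
Lemma mul_vfluxE vf (tau : R) : exists sg : R, forall c um up,
  c * vflux vf tau c um up = c * ((um + up) / 2) + `|c| * (sg * (um - up) / 2).
Proof.
case: vf => /=; first by exists 0 => c um up; rewrite !mul0r mulr0 addr0.
have [t0|t0] := ltP tau 0; [exists (-1)|exists 1] => c um up;
  have [c0|c0] := leP 0 c; rewrite ?(ger0_norm c0) ?(ltr0_norm c0); by field.
Qed.

(* Although the upwind flux jumps where the speed [c] changes sign, its product
   with [c] is continuous. *)
Lemma continuous_mul_vflux vf (tau : R) (c um up : R -> R) :
  continuous c -> continuous um -> continuous up ->
  continuous (fun v => c v * vflux vf tau (c v) (um v) (up v)).
Proof.
move=> cc cm cp; have [sg E] := mul_vfluxE vf tau.
under eq_fun do rewrite E.
move=> v; apply: cvgD; apply: cvgM.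
- exact: cc.
- by apply: cvgMr_tmp; apply: cvgD; [exact: cm|exact: cp].
- by apply: cvg_norm; exact: cc.
- apply: cvgMr_tmp; apply: cvgMl_tmp; apply: cvgB; [exact: cm|exact: cp].
Qed.

(** Continuity of the integrands allows the sum to enter the integral, where the fluxes telescope at
    each fixed [v]. The mesh [M] is crossed by the fluxes, [M'] runs along the faces. *)
Lemma velocity_flux_sum (c d : R) (M' : mesh c d) (j' : 'I_(ncell M')) vf tau
    (s : R -> R) (U : 'I_(ncell M) -> R -> R -> R) (q : R -> R -> R) :
  continuous s -> (forall j x, continuous (U j x)) ->
  (forall x, continuous (q x)) ->
  \sum_j cell_int j' (fun v => s v *
    (flux0_r (vflux vf tau (s v)) (fun i x => U i x v) j * q (cell_r j) v
     - flux0_l (vflux vf tau (s v)) (fun i x => U i x v) j * q (cell_l j) v))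
  = 0.
Proof.
move=> cs cU cq; rewrite -Rintegral_sum.
  rewrite (_ : (fun v => _) = fun=> 0).
    by rewrite Rintegral_cst// mul0r.
  by apply/funext => v; rewrite -mulr_sumr (flux0_telescope _ _ (q^~ v)) mulr0.
move=> j; under eq_fun do rewrite mulrBr !mulrA.
move=> v; apply: cvgB; apply: cvgM; try exact: cq.
- rewrite /flux0_r; case: eqP => _.
    by apply: cvgM; [exact: cs|exact: cvg_cst].
  exact: (@continuous_mul_vflux vf tau s (U _ _) (U _ _)).
- rewrite /flux0_l; case: eqP => _.
    by apply: cvgM; [exact: cs|exact: cvg_cst].
  exact: (@continuous_mul_vflux vf tau s (U _ _) (U _ _)).
Qed.

End Fluxes.

(** * Energy balance of the substeps *)

Section EnergyConservation.
Variables (R : realType) (k : nat) (L V1c V2c : R).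
Variables (Mx : mesh 0 L) (M1 : mesh (- V1c) V1c) (M2 : mesh (- V2c) V2c).
Variable xi : 'I_k.+1 -> R.
Variables (vf : vlasov_flux) (mf : maxwell_flux).
Hypothesis k2 : (2 <= k)%N.
Hypothesis xiP : gauss_nodes xi.

Implicit Types (g h f : pw_v M1 M2) (s : state Mx M1 M2) (u : pw_x Mx).

(** * Kinetic energy and the velocity form *)

Lemma poly_deg_sqr n : (2 <= n)%N -> poly_deg n (fun x : R => x ^+ 2).
Proof. by move=> n2; apply: poly_deg_leq n2 (poly_degX R 2). Qed.

Definition speed2 : R -> R -> R := fun v1 v2 => v1 ^+ 2 + v2 ^+ 2.

Lemma is_Qk2_speed2 : is_Qk2 k speed2.
Proof.
apply: is_Qk2D.
- have -> : (fun x _ => x ^+ 2) = (fun x y : R => x ^+ 2 * 1 : R).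
    by apply/funext => x; apply/funext => y; rewrite mulr1.
  by apply: (@is_Qk2M _ _ (fun x => x ^+ 2) (fun=> 1));
    [exact: poly_deg_sqr | exact: poly_deg_cst].
- have -> : (fun _ y => y ^+ 2) = (fun x y : R => 1 * y ^+ 2 : R).
    by apply/funext => x; apply/funext => y; rewrite mul1r.
  by apply: (@is_Qk2M _ _ (fun=> 1) (fun x => x ^+ 2));
    [exact: poly_deg_cst | exact: poly_deg_sqr].
Qed.

Lemma poly_deg2_speed2 n : (2 <= n)%N -> poly_deg2 n speed2.
Proof.
move=> n2; apply: poly_deg2D.
  exact/(poly_deg2_fst (poly_deg_sqr _)).
exact/(poly_deg2_snd (poly_deg_sqr _)).
Qed.

(** Twice the physical kinetic energy: the factor 1/2 is applied once, in [total_energy]. *)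
Definition kinetic h : R :=
  v_int (fun j1 j2 v1 v2 => h j1 j2 v1 v2 * speed2 v1 v2).

Lemma Z_h_poly_deg2 h : Z_h k h -> pw_poly_deg2 k h.
Proof. by move=> hZ j1 j2; apply: is_Qk2_poly_deg2; exact: hZ. Qed.

Lemma Z_h_kinetic_poly h : Z_h k h ->
  pw_poly_deg2 k.*2.+1 (fun j1 j2 v1 v2 => h j1 j2 v1 v2 * speed2 v1 v2).
Proof.
move=> /Z_h_poly_deg2 hZ j1 j2.
apply: (@poly_deg2_leq _ (k + 2)); first by lia.
by apply: poly_deg2M; [exact: hZ|exact: poly_deg2_speed2].
Qed.

Lemma derive1_sqrD (c x : R) : derive1 (fun w => w ^+ 2 + c) x = 2 * x.
Proof.
have -> : (fun w => w ^+ 2 + c) = horner ('X^2 + c%:P).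
  by apply/funext => w; rewrite !hornerE.
by rewrite -derivE derivD derivC derivXn !hornerE /= mulr_natl.
Qed.

Lemma derive1_Dsqr (c x : R) : derive1 (fun w => c + w ^+ 2) x = 2 * x.
Proof. by under eq_fun do rewrite addrC; exact: derive1_sqrD. Qed.

Lemma midv_poly g f : Z_h k g -> Z_h k f -> pw_poly_deg2 k (midv g f).
Proof.
move=> /Z_h_poly_deg2 gZ /Z_h_poly_deg2 fZ j1 j2.
by apply: poly_deg2Zr; apply: poly_deg2D; [exact: gZ|exact: fZ].
Qed.

(** Velocity fields of degree 1 cover both the constant fields of Scheme-b and the magnetic rotation
    of Scheme-c. *)
Lemma work_poly g f (a1 a2 : R -> R) : Z_h k g -> Z_h k f ->
  poly_deg 1 a1 -> poly_deg 1 a2 ->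
  pw_poly_deg2 k.*2.+1 (fun j1 j2 v1 v2 =>
    midv g f j1 j2 v1 v2 * (a1 v2 * v1 + a2 v1 * v2)).
Proof.
move=> gZ fZ a1P a2P j1 j2; apply: (@poly_deg2_leq _ (k + 2)); first by lia.
apply: poly_deg2M; first exact: midv_poly.
apply: poly_deg2D; apply: (@poly_deg2M _ 1 1 (fun _ _ => _) (fun _ _ => _)).
- exact: poly_deg2_snd.
- exact/poly_deg2_fst/poly_deg_id.
- exact: poly_deg2_fst.
- exact/poly_deg2_snd/poly_deg_id.
Qed.

Lemma Dform_speed2_sum tau g f (a1 a2 : R -> R) : Z_h k g -> Z_h k f ->
  poly_deg 1 a1 -> poly_deg 1 a2 ->
  \sum_j2 \sum_j1 Dform vf tau (midv g f) a1 a2 (fun _ _ => speed2) j1 j2 =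
  - (2 * v_int (fun j1 j2 v1 v2 =>
      midv g f j1 j2 v1 v2 * (a1 v2 * v1 + a2 v1 * v2))).
Proof.
move=> gZ fZ a1P a2P.
have mP := midv_poly gZ fZ.
under eq_bigr do rewrite !big_split /=.
rewrite !big_split /=.
(* Faces normal to [v1]: the fluxes cancel in the sum over [j1]. *)
rewrite [X in _ + X + _]big1 ?addr0; last first.
  move=> j2 _; apply: (@velocity_flux_sum _ _ _ M1 _ _ M2 j2 vf tau a1
    (fun j v1 v2 => midv g f j j2 v1 v2) speed2).
  - exact: poly_deg_continuous a1P.
  - by move=> j x; apply: poly_deg_continuous; exact: (mP _ _).2.
  - by move=> x; apply: poly_deg_continuous; exact: (poly_deg2_speed2 k2).2.
(* Faces normal to [v2]: the sum over [j2] must come innermost first. *)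
rewrite [X in _ + X]exchange_big [X in _ + X]big1 ?addr0; last first.
  move=> j1 _; apply: (@velocity_flux_sum _ _ _ M2 _ _ M1 j1 vf tau a2
    (fun j v2 v1 => midv g f j1 j v1 v2) (fun v2 v1 => speed2 v1 v2)).
  - exact: poly_deg_continuous a2P.
  - by move=> j x; apply: poly_deg_continuous; exact: (mP _ _).1.
  - by move=> x; apply: poly_deg_continuous; exact: (poly_deg2_speed2 k2).1.
under eq_bigr do rewrite sumrN.
rewrite sumrN -(v_intZ xiP); last exact: work_poly.
congr (- _); apply: eq_bigr => j2 _; apply: eq_bigr => j1 _.
congr cell_int; apply/funext => v2; congr cell_int; apply/funext => v1.
by rewrite /speed2 derive1_sqrD derive1_Dsqr; ring.
Qed.

(* Testing with |v|^2, which lies in Z_h because k >= 2, and summing over the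
   velocity cells cancels all the fluxes. *)
Lemma kinetic_balance tau g f (a1 a2 : R -> R) : tau != 0 ->
  Z_h k g -> Z_h k f -> poly_deg 1 a1 -> poly_deg 1 a2 ->
  (forall j1 j2 (phi : pw_v M1 M2), Z_h k phi ->
    cell_int j2 (fun v2 => cell_int j1 (fun v1 =>
      (g j1 j2 v1 v2 - f j1 j2 v1 v2) / tau * phi j1 j2 v1 v2))
    + Dform vf tau (midv g f) a1 a2 phi j1 j2 = 0) ->
  kinetic g = kinetic f + 2 * tau * v_int (fun j1 j2 v1 v2 =>
    midv g f j1 j2 v1 v2 * (a1 v2 * v1 + a2 v1 * v2)).
Proof.
move=> tau0 gZ fZ a1P a2P eqn.
pose dif : pw_v M1 M2 := fun j1 j2 v1 v2 =>
  (g j1 j2 v1 v2 - f j1 j2 v1 v2) / tau * speed2 v1 v2.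
have difP : pw_poly_deg2 k.*2.+1 dif.
  move=> j1 j2; apply: (@poly_deg2_leq _ (k + 2)); first by lia.
  apply: poly_deg2M; last exact: poly_deg2_speed2.
  by apply: poly_deg2Zr; apply: poly_deg2B; exact: Z_h_poly_deg2.
have : v_int dif + \sum_j2 \sum_j1
    Dform vf tau (midv g f) a1 a2 (fun _ _ => speed2) j1 j2 = 0.
  rewrite -big_split big1// => j2 _; rewrite /= -big_split big1// => j1 _ /=.
  by apply: (eqn j1 j2 (fun _ _ => speed2)) => ? ?; exact: is_Qk2_speed2.
rewrite Dform_speed2_sum// => /eqP; rewrite subr_eq0 => /eqP work.
(* By [work], the added term is [tau] times the integral of [dif], that is, the kinetic
   increment. *)
rewrite [2 * tau]mulrC -mulrA -work -(v_intZ xiP)// -(v_intD xiP).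
- apply: eq_bigr => j2 _; apply: eq_bigr => j1 _.
  congr cell_int; apply/funext => v2; congr cell_int; apply/funext => v1.
  by rewrite /dif; field.
- exact: Z_h_kinetic_poly.
- by move=> j1 j2; apply: poly_deg2Z; exact: difP.
Qed.

(** The composite Gauss rule, taken on nodal values because Scheme-b and Scheme-c update [f] node by
    node in x. *)
Definition x_quad (F : 'I_(ncell Mx) -> 'I_k.+1 -> R) : R :=
  \sum_i \sum_l cell_weight xi i l * F i l.

Lemma x_quadE u : (forall i, poly_deg k.*2.+1 (u i)) ->
  \sum_i cell_int i (u i) = x_quad (fun i l => u i (xpt xi i l)).
Proof. by move=> uP; apply: eq_bigr => i _; rewrite (gauss_quadrature xiP). Qed.

Lemma x_quadD F G : x_quad (fun i l => F i l + G i l) = x_quad F + x_quad G.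
Proof.
by do 2![rewrite -big_split; apply: eq_bigr => ? _ /=]; rewrite mulrDr.
Qed.

Lemma x_quadZ c F : x_quad (fun i l => c * F i l) = c * x_quad F.
Proof.
by do 2![rewrite mulr_sumr; apply: eq_bigr => ? _ /=]; rewrite mulrCA.
Qed.

Lemma eq_x_quad F G : (forall i l, F i l = G i l) -> x_quad F = x_quad G.
Proof. by move=> FG; do 2!apply: eq_bigr => ? _; rewrite FG. Qed.

Lemma x_quad_balance c D F G : x_quad D = 0 ->
  (forall i l, F i l = G i l + c * D i l) -> x_quad F = x_quad G.
Proof.
by move=> D0 /eq_x_quad ->; rewrite x_quadD x_quadZ D0 mulr0 addr0.
Qed.

Lemma slice_Z_h s i l : in_spaces k s -> Z_h k (slice xi (sf s) i l).
Proof. by case=> sS _ _ _ j1 j2; exact: (is_Qk3_poly_deg (sS i j1 j2)).2. Qed.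

Lemma W_h_sqr u i : W_h k u -> poly_deg k.*2.+1 (fun x => `|u i x| ^+ 2).
Proof.
move=> uW; have /is_PkE uP := uW i; under eq_fun do rewrite real_normK ?num_real//.
apply: (@poly_deg_leq _ (k + k)); first by lia.
by under eq_fun do rewrite expr2; exact: poly_degM.
Qed.

(** In x the distribution has degree at most [k] and the squared fields at most 2k, so the Gauss
    rule is exact on both. *)
Lemma total_energyE s : in_spaces k s ->
  total_energy s = x_quad (fun i l =>
    (kinetic (slice xi (sf s) i l) + (sE1 s i (xpt xi i l) ^+ 2
     + sE2 s i (xpt xi i l) ^+ 2 + sB3 s i (xpt xi i l) ^+ 2)) / 2).
Proof.
move=> sP; have [sS E1W E2W B3W] := sP.
rewrite (@eq_x_quad _ (fun i l => 2^-1 * (kinetic (slice xi (sf s) i l)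
    + (sE1 s i (xpt xi i l) ^+ 2 + sE2 s i (xpt xi i l) ^+ 2
       + sB3 s i (xpt xi i l) ^+ 2)))); last by move=> i l; rewrite mulrC.
rewrite x_quadZ mulrC; congr (_ * _); rewrite x_quadD; congr (_ + _); last first.
  rewrite (x_quadE (u := fun i x => _)); last first.
    by move=> i; do 2?apply: poly_degD; exact: W_h_sqr.
  by apply: eq_x_quad => i l; rewrite !real_normK ?num_real.
apply: eq_bigr => i _; rewrite /kinetic /v_int.
under [RHS]eq_bigr do rewrite mulr_sumr.
rewrite [RHS]exchange_big; apply: eq_bigr => j2 _ /=.
under [RHS]eq_bigr do rewrite mulr_sumr.
rewrite [RHS]exchange_big; apply: eq_bigr => j1 _ /=.
have [fx fv] := is_Qk3_poly_deg (sS i j1 j2).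
have hP x : poly_deg2 k.*2.+1 (fun v1 v2 => sf s i j1 j2 x v1 v2 * speed2 v1 v2).
  apply: (@poly_deg2_leq _ (k + 2)); first by lia.
  by apply: poly_deg2M; [exact: is_Qk2_poly_deg2|exact: poly_deg2_speed2].
rewrite (gauss_quadrature xiP)//.
under eq_fun do rewrite (gauss_quadrature2 xiP)//.
do 2![apply: poly_deg_sum => ?]; apply: poly_degZ; apply: poly_degZr.
by apply: poly_deg_leq (fx _ _); lia.
Qed.

(** The integrand has degree at most k+2, within the exactness 2k+1, so only nodal values matter.
    This passes from the auxiliary solution [g] to the updated distribution. *)
Lemma kinetic_gauss_eq h f : Z_h k h -> Z_h k f ->
  (forall j1 j2 m1 m2, h j1 j2 (v1pt xi j1 m1) (v2pt xi j2 m2) =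
    f j1 j2 (v1pt xi j1 m1) (v2pt xi j2 m2)) ->
  kinetic h = kinetic f.
Proof.
move=> hZ fZ hf; rewrite /kinetic !(v_int_gauss xiP); do ?exact: Z_h_kinetic_poly.
by do 4!apply: eq_bigr => ? _; rewrite hf.
Qed.

(** * Scheme-a: transport in x *)

Lemma scheme_a_kinetic tau s s' : tau != 0 -> in_spaces k s ->
  scheme_a xi vf tau s s' ->
  x_quad (fun i l => kinetic (slice xi (sf s') i l)) =
  x_quad (fun i l => kinetic (slice xi (sf s) i l)).
Proof.
move=> tau0 sP [s'P [_ [_ [_ advect]]]].
(* With the velocity nodes outermost, each inner sum is the mass in x carried by one of them. *)
have expand (r : state Mx M1 M2) : in_spaces k r ->
    x_quad (fun i l => kinetic (slice xi (sf r) i l)) =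
    \sum_j2 \sum_j1 \sum_m2 \sum_m1
      (cell_weight xi j2 m2 * cell_weight xi j1 m1 *
       speed2 (v1pt xi j1 m1) (v2pt xi j2 m2)) *
      x_quad (fun i l =>
        sf r i j1 j2 (xpt xi i l) (v1pt xi j1 m1) (v2pt xi j2 m2)).
  move=> rP.
  pose G i l j2 j1 m2 m1 := cell_weight xi j2 m2 * cell_weight xi j1 m1 *
    speed2 (v1pt xi j1 m1) (v2pt xi j2 m2) * (cell_weight xi i l *
    sf r i j1 j2 (xpt xi i l) (v1pt xi j1 m1) (v2pt xi j2 m2)).
  transitivity (\sum_i \sum_l \sum_j2 \sum_j1 \sum_m2 \sum_m1 G i l j2 j1 m2 m1).
    apply: eq_bigr => i _; apply: eq_bigr => l _.
    rewrite /kinetic (v_int_gauss xiP); last exact/Z_h_kinetic_poly/slice_Z_h.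
    do 4![rewrite mulr_sumr; apply: eq_bigr => ? _ /=].
    by rewrite /G /slice; ring.
  under eq_bigr do rewrite exchange_big /=.
  rewrite exchange_big; apply: eq_bigr => j2 _ /=.
  under eq_bigr do rewrite exchange_big /=.
  rewrite exchange_big; apply: eq_bigr => j1 _ /=.
  under eq_bigr do rewrite exchange_big /=.
  rewrite exchange_big; apply: eq_bigr => m2 _ /=.
  under eq_bigr do rewrite exchange_big /=.
  rewrite exchange_big; apply: eq_bigr => m1 _ /=.
  rewrite -x_quadZ; apply: eq_bigr => i _; apply: eq_bigr => l _.
  by rewrite /G; ring.
rewrite !expand//.
apply: eq_bigr => j2 _; apply: eq_bigr => j1 _.
apply: eq_bigr => m2 _; apply: eq_bigr => m1 _; congr (_ * _).
have [g [gW eqn fg]] := advect j1 j2 m1 m2.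
pose fn : pw_x Mx := fun i x => sf s i j1 j2 x (v1pt xi j1 m1) (v2pt xi j2 m2).
have gP i : poly_deg k (g i) by apply/is_PkE; exact: gW.
have fP i : poly_deg k (fn i).
  by have [sS _ _ _] := sP; exact: (is_Qk3_poly_deg (sS i j1 j2)).1.
have one : W_h k (fun (i : 'I_(ncell Mx)) (x : R) => 1 : R).
  by move=> i; apply/is_PkE; exact: poly_deg_cst.
transitivity (x_quad (fun i l => g i (xpt xi i l))).
  by apply: eq_x_quad => i l; rewrite fg.
have dP i : poly_deg k.*2.+1 (fun x => (g i x - fn i x) / tau * 1).
  apply: (@poly_deg_leq _ k); first by lia.
  by apply/poly_degZr/poly_degZr/poly_degB.
have : x_quad (fun i l => (g i (xpt xi i l) - fn i (xpt xi i l)) / tau * 1) = 0.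
  rewrite -(x_quadE (u := fun i x => (g i x - fn i x) / tau * 1))//.
  set a := v2pt xi j2 m2 in eqn.
  pose gb : pw_x Mx := fun i x => (g i x + fn i x) / 2.
  (* The test function 1 has zero derivative, so each cell retains only its two fluxes. *)
  transitivity (\sum_i (a * flux_l (vflux vf tau a) gb i
                        - a * flux_r (vflux vf tau a) gb i)).
    apply: eq_bigr => i _; have /= := eqn i _ one.
    rewrite -/fn -/gb !mulr1.
    have -> : cell_int i (fun x => a * gb i x * derive1 (fun _ : R => 1 : R) x) = 0.
      rewrite (_ : (fun x => _) = fun=> 0) /cell_int ?Rintegral_cst ?mul0r//.
      by apply/funext => x; rewrite derive1_cst mulr0.
    rewrite subr0 => /eqP; rewrite subr_eq0 addrC => /eqP <-.
    by rewrite addrAC subrr add0r.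
  by rewrite sumrB -!mulr_sumr flux_r_sum subrr.
move=> /(@x_quad_balance tau); apply => i l.
by rewrite /fn mulr1 mulrC divfK// addrC subrK.
Qed.

Lemma scheme_a_energy tau s s' : tau != 0 -> in_spaces k s ->
  scheme_a xi vf tau s s' -> total_energy s = total_energy s'.
Proof.
move=> tau0 sP st; have [s'P [E1 [E2 [B3 _]]]] := st.
rewrite !total_energyE// E1 E2 B3.
have split (r : state Mx M1 M2) (G : 'I_(ncell Mx) -> 'I_k.+1 -> R) :
    x_quad (fun i l => (kinetic (slice xi (sf r) i l) + G i l) / 2) =
    2^-1 * (x_quad (fun i l => kinetic (slice xi (sf r) i l)) + x_quad G).
  by rewrite -x_quadD -x_quadZ; apply: eq_x_quad => i l; rewrite mulrC.
by rewrite !split (scheme_a_kinetic tau0 sP st).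
Qed.

(** * Scheme-b: electric acceleration and currents *)

Lemma work_current g f (c1 c2 : R) : Z_h k g -> Z_h k f ->
  v_int (fun j1 j2 v1 v2 => midv g f j1 j2 v1 v2 * (c1 * v1 + c2 * v2)) =
  c1 * ((current1 f + current1 g) / 2) + c2 * ((current2 f + current2 g) / 2).
Proof.
move=> gZ fZ.
have momentP h (hZ : Z_h k h) (q : R -> R -> R) : poly_deg2 1 q ->
    pw_poly_deg2 k.*2.+1 (fun j1 j2 v1 v2 => h j1 j2 v1 v2 * q v1 v2).
  move=> qP j1 j2; apply: (@poly_deg2_leq _ (k + 1)); first by lia.
  by apply: poly_deg2M => //; exact: Z_h_poly_deg2.
have q1 : poly_deg2 1 (fun v1 _ : R => v1) by apply/poly_deg2_fst/poly_deg_id.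
have q2 : poly_deg2 1 (fun _ v2 : R => v2) by apply/poly_deg2_snd/poly_deg_id.
have f1 := momentP _ fZ _ q1; have g1 := momentP _ gZ _ q1.
have f2 := momentP _ fZ _ q2; have g2 := momentP _ gZ _ q2.
rewrite -!(mulrC 2^-1) /current1 /current2 -(v_intD xiP f1 g1).
rewrite -(v_intD xiP f2 g2) -!(v_intZ xiP) -?(v_intD xiP).
  apply: eq_bigr => j2 _; apply: eq_bigr => j1 _.
  congr cell_int; apply/funext => v2; congr cell_int; apply/funext => v1.
  by rewrite /midv; field.
all: move=> j1 j2; do ?apply: poly_deg2Z; apply: poly_deg2D.
all: by [exact: f1 | exact: g1 | exact: f2 | exact: g2].
Qed.

Lemma scheme_b_energy tau s s' : tau != 0 -> in_spaces k s ->
  scheme_b xi vf tau s s' -> total_energy s = total_energy s'.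
Proof.
move=> tau0 sP [s'P [B3 st]]; rewrite !total_energyE// B3.
(* Scheme-b does not couple the x nodes, so the energy is conserved at each of them. *)
apply: eq_x_quad => i l; congr (_ / _).
have [g [e1 [e2 [gZ eqn [d1 d2] fg [-> ->]]]]] := st i l.
have fZ := slice_Z_h i l sP.
rewrite (@kinetic_gauss_eq (slice xi (sf s') i l) g)//; last exact: slice_Z_h.
rewrite (kinetic_balance tau0 gZ fZ _ _ eqn); try exact: poly_deg_cst.
rewrite work_current//.
move: d1 d2; set f := slice _ _ _ _; set e1n := sE1 _ _ _.
set e2n := sE2 _ _ _ => d1 d2.
have := mulfVK tau0 (e1 - e1n); rewrite d1 => e1E.
have := mulfVK tau0 (e2 - e2n); rewrite d2 => e2E.
(* The sum is twice the mean field and the difference is -[tau] times the mean current: the change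
   of the square is the opposite of the kinetic gain. *)
have -> : e1 ^+ 2 = e1n ^+ 2 + (e1n + e1) * (e1 - e1n) by ring.
have -> : e2 ^+ 2 = e2n ^+ 2 + (e2n + e2) * (e2 - e2n) by ring.
by rewrite -e1E -e2E; field.
Qed.

(** * Scheme-c: Maxwell's equations and magnetic rotation *)

(** A discrete product rule: the jump of a product splits exactly when the two factors are taken
    from opposite sides, or both averaged. *)
Lemma mflux_jump em ep bm bp :
  bm * em - bp * ep =
  mflux_B mf bm bp * (em - ep) + mflux_E mf em ep * (bm - bp) :> R.
Proof. by case: mf => /=; field. Qed.

(** A cyclic shift of the left-end terms regroups the sums by interface, where [mflux_jump]
    applies. *)
Lemma mflux_sum (e b : pw_x Mx) :
  \sum_i (b i (cell_r i) * e i (cell_r i) - b i (cell_l i) * e i (cell_l i)) =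
  \sum_i (flux_r (mflux_B mf) b i * e i (cell_r i)
          - flux_l (mflux_B mf) b i * e i (cell_l i)
          + (flux_r (mflux_E mf) e i * b i (cell_r i)
             - flux_l (mflux_E mf) e i * b i (cell_l i))).
Proof.
rewrite [RHS]big_split /= !sumrB -(big_ordS (fun i => b i (cell_l i) * _)).
rewrite -(big_ordS (fun i => flux_l _ b i * _)).
rewrite -(big_ordS (fun i => flux_l _ e i * _)) -!sumrB -big_split /=.
apply: eq_bigr => i _; rewrite !flux_l_ordS -!mulrBr.
exact: mflux_jump.
Qed.

Lemma maxwell_energy tau (E B E' B' : pw_x Mx) : tau != 0 ->
  W_h k E -> W_h k B -> W_h k E' -> W_h k B' ->
  let Ebar : pw_x Mx := fun i x => (E' i x + E i x) / 2 in
  let Bbar : pw_x Mx := fun i x => (B' i x + B i x) / 2 in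
  (forall (i : 'I_(ncell Mx)) (phi : pw_x Mx), W_h k phi ->
     cell_int i (fun x => (E' i x - E i x) / tau * phi i x)
     = - cell_int i (fun x => Bbar i x * derive1 (phi i) x)
       + flux_r (mflux_B mf) Bbar i * phi i (cell_r i)
       - flux_l (mflux_B mf) Bbar i * phi i (cell_l i)) ->
  (forall (i : 'I_(ncell Mx)) (phi : pw_x Mx), W_h k phi ->
     cell_int i (fun x => (B' i x - B i x) / tau * phi i x)
     = - cell_int i (fun x => Ebar i x * derive1 (phi i) x)
       + flux_r (mflux_E mf) Ebar i * phi i (cell_r i)
       - flux_l (mflux_E mf) Ebar i * phi i (cell_l i)) ->
  x_quad (fun i l => E' i (xpt xi i l) ^+ 2 + B' i (xpt xi i l) ^+ 2) =
  x_quad (fun i l => E i (xpt xi i l) ^+ 2 + B i (xpt xi i l) ^+ 2).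
Proof.
move=> tau0 EW BW E'W B'W Ebar Bbar eqE eqB.
have EP i : poly_deg k (E i) by apply/is_PkE; exact: EW.
have BP i : poly_deg k (B i) by apply/is_PkE; exact: BW.
have E'P i : poly_deg k (E' i) by apply/is_PkE; exact: E'W.
have B'P i : poly_deg k (B' i) by apply/is_PkE; exact: B'W.
have EbP i : poly_deg k (Ebar i) by apply/poly_degZr/poly_degD.
have BbP i : poly_deg k (Bbar i) by apply/poly_degZr/poly_degD.
have EbW : W_h k Ebar by move=> i; apply/is_PkE.
have BbW : W_h k Bbar by move=> i; apply/is_PkE.
have prodP (u v w : pw_x Mx) i : poly_deg k (u i) -> poly_deg k (v i) ->
    poly_deg k (w i) -> poly_deg k.*2.+1 (fun x => (u i x - v i x) / tau * w i x).
  move=> ? ? ?; apply: (@poly_deg_leq _ (k + k)); first by lia.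
  by apply: poly_degM => //; apply/poly_degZr/poly_degB.
(* The volume terms of the two equations, tested with the mean fields, form a total derivative and
   reduce to end values. *)
have parts i : cell_int i (fun x => Bbar i x * derive1 (Ebar i) x)
    + cell_int i (fun x => Ebar i x * derive1 (Bbar i) x)
    = Bbar i (cell_r i) * Ebar i (cell_r i)
      - Bbar i (cell_l i) * Ebar i (cell_l i).
  rewrite /cell_int -RintegralD//; last first.
  - apply/continuous_Rintegrable/poly_deg_continuous/poly_degM; first exact: EbP.
    exact/poly_deg_derive1/BbP.
  - apply/continuous_Rintegrable/poly_deg_continuous/poly_degM; first exact: BbP.
    exact/poly_deg_derive1/EbP.
  rewrite -(Rintegral_derive1 (cell_lr i) (poly_degM (BbP i) (EbP i))).
  by apply: eq_Rintegral => x _; rewrite (derive1M_poly _ (BbP i) (EbP i)).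
have : x_quad (fun i l =>
    (E' i (xpt xi i l) - E i (xpt xi i l)) / tau * Ebar i (xpt xi i l) +
    (B' i (xpt xi i l) - B i (xpt xi i l)) / tau * Bbar i (xpt xi i l)) = 0.
  rewrite x_quadD.
  rewrite -(x_quadE (u := fun i x => (E' i x - E i x) / tau * Ebar i x)); last first.
    by move=> i; exact: prodP.
  rewrite -(x_quadE (u := fun i x => (B' i x - B i x) / tau * Bbar i x)); last first.
    by move=> i; exact: prodP.
  under eq_bigr do rewrite eqE//.
  under [X in _ + X]eq_bigr do rewrite eqB//.
  have /esym/eqP := mflux_sum Ebar Bbar.
  rewrite -(eq_bigr _ (fun i _ => parts i)) -subr_eq0 -sumrB => /eqP h.
  apply: (eq_trans _ h); rewrite -big_split.
  by apply: eq_bigr => i _ /=; ring.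
(* The factor 2 [tau] arises because an increment times the mean is half the difference of
   squares. *)
move=> /(@x_quad_balance (2 * tau)); apply => i l.
by rewrite /Ebar /Bbar; field.
Qed.

Lemma scheme_c_energy tau s s' : tau != 0 -> in_spaces k s ->
  scheme_c xi vf mf tau s s' -> total_energy s = total_energy s'.
Proof.
move=> tau0 sP [s'P [E2 [eqE eqB st]]].
have [_ E1W _ B3W] := sP; have [_ E1W' _ B3W'] := s'P.
have mx := maxwell_energy tau0 E1W B3W E1W' B3W' eqE eqB.
have fE i l : kinetic (slice xi (sf s') i l) = kinetic (slice xi (sf s) i l).
  have [g [gZ eqn fg]] := st i l.
  have fZ := slice_Z_h i l sP.
  rewrite (@kinetic_gauss_eq (slice xi (sf s') i l) g)//; last exact: slice_Z_h.
  move: eqn; set b := (_ / 2) => eqn.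
  rewrite (@kinetic_balance tau g (slice xi (sf s) i l)
    (fun v2 => v2 * b) (fun v1 => - v1 * b))//.
  (* The magnetic work v2 b v1 - v1 b v2 cancels pointwise; its integral is obtained as a multiple
     by 0. *)
  - rewrite (_ : v_int _ = 0) ?mulr0 ?addr0//.
    transitivity (0 * v_int ((fun _ _ _ _ => 0) : pw_v M1 M2)); last exact: mul0r.
    rewrite -(v_intZ xiP).
      apply: eq_bigr => j2 _; apply: eq_bigr => j1 _.
      congr cell_int; apply/funext => v2; congr cell_int; apply/funext => v1.
      by ring.
    by move=> j1 j2; split=> z; exact: poly_deg_cst.
  - exact/poly_degZr/poly_deg_id.
  - by under eq_fun do rewrite mulNr -mulrN; exact/poly_degZr/poly_deg_id.
  - move=> j1 j2 phi phiZ; rewrite -(eqn j1 j2 phi phiZ); congr (_ + _).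
    apply/esym; apply: (cell_int_exchange xiP _ _ (h := fun v1 v2 => _)).
    apply: (@poly_deg2_leq _ (k + k)); first by lia.
    apply: poly_deg2M; last exact: Z_h_poly_deg2.
    by apply/poly_deg2Zr/poly_deg2B; exact: Z_h_poly_deg2.
have split (r : state Mx M1 M2) : in_spaces k r -> sE2 r = sE2 s ->
    (forall i l, kinetic (slice xi (sf r) i l) = kinetic (slice xi (sf s) i l)) ->
    total_energy r = 2^-1 * (x_quad (fun i l =>
        kinetic (slice xi (sf s) i l) + sE2 s i (xpt xi i l) ^+ 2)
      + x_quad (fun i l => sE1 r i (xpt xi i l) ^+ 2 + sB3 r i (xpt xi i l) ^+ 2)).
  move=> rP rE2 rK; rewrite total_energyE// rE2 -x_quadD -x_quadZ.
  by apply: eq_x_quad => i l; rewrite rK; field.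
by rewrite (split s)// (split s')// mx.
Qed.

(** Steps of either sign are covered, since the middle stage of Scheme-5F runs backward; membership
    in the spaces is returned to chain the stages. *)
Lemma scheme_5_energy tau s s' : tau != 0 -> in_spaces k s ->
  scheme_5 xi vf mf tau s s' ->
  in_spaces k s' /\ total_energy s = total_energy s'.
Proof.
move=> tau0 s0P [s1 [s2 [s3 [s4 [a1 [b1 [c1 [b2 a2]]]]]]]].
have half0 : tau / 2 != 0 by rewrite mulf_neq0// invr_eq0 pnatr_eq0.
have s1P := a1.1; have s2P := b1.1; have s3P := c1.1; have s4P := b2.1.
split; first exact: a2.1.
rewrite (scheme_a_energy half0 s0P a1) (scheme_b_energy half0 s1P b1).
rewrite (scheme_c_energy tau0 s2P c1) (scheme_b_energy half0 s3P b2).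
exact: (scheme_a_energy half0 s4P a2).
Qed.

End EnergyConservation.

(** Both powers of 2 are positive, so twice [beta1] exceeds 4/3. Hence [beta1] is positive and
    [beta2] negative, and no stage has step 0. *)
Lemma beta1_gt (R : realType) : 1 < 2 * beta1 R.
Proof.
rewrite /beta1; have p : 0 < (2 : R) `^ 3^-1 by apply: powR_gt0; lra.
have q : 0 < (2 : R) `^ (- 3^-1) by apply: powR_gt0; lra.
lra.
Qed.

Theorem theorem3p5 (R : realType) (k : nat) (L V1c V2c : R)
    (Mx : mesh 0 L) (M1 : mesh (- V1c) V1c) (M2 : mesh (- V2c) V2c)
    (xi : 'I_k.+1 -> R) (vf : vlasov_flux) (mf : maxwell_flux)
    (dt : R) (s s' : state Mx M1 M2) :
  (2 <= k)%N -> 0 < L -> 0 < V1c -> 0 < V2c ->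
  gauss_nodes xi ->
  0 < dt ->
  in_spaces k s ->
  scheme_5 xi vf mf dt s s' \/ scheme_5F xi vf mf dt s s' ->
  total_energy s = total_energy s'.
Proof.
move=> k2 _ _ _ xiP dt0 sP.
have dtn0 : dt != 0 by rewrite gt_eqF.
have beta_gt := beta1_gt R.
have t1 : beta1 R * dt != 0 by rewrite mulf_neq0// gt_eqF//; lra.
have t2 : beta2 R * dt != 0.
  by rewrite mulf_neq0// lt_eqF// /beta2 subr_lt0.
case=> [st|[s1 [s2 [st1 [st2 st3]]]]].
  exact: (scheme_5_energy k2 xiP dtn0 sP st).2.
have [s1P ->] := scheme_5_energy k2 xiP t1 sP st1.
have [s2P ->] := scheme_5_energy k2 xiP t2 s1P st2.
(* [beta3] unfolds to [beta1], so [t1] also serves the last stage. *)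
exact: (scheme_5_energy k2 xiP t1 s2P st3).2.
Qed.
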